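(* (Even-derivative, odd-centered stencil case) Let $f:(a,b)\to\mathbb R$ be a sufficiently differentiable function over an open interval $(a,b)$, and let $x_*\in(a,b)$. Suppose $k=2\ell$ and $N=2M+1$ for some $\ell,M\in\mathbb N$, assuming $N-k\ge 1$. Then, for a given $N$-point, odd-centered stencil, with fundamental stencil $\{a_n\}$ and stencil size $h>0$, there exists a unique set of coefficients $\{c_n\}$ such that $$D^k f(x_* ) := \sum_{n=-M}^M c_nf(x_*+a_nh)$$ is a finite difference approximation of $f^{(k)}(x_* )$ with accuracy order exactly $N-k+1$, assuming $f^{(N+1)}(x_* )\neq 0$. In other words, $$\left| D^k f(x_* ) - f^{(k)}(x_* )\right| = \Theta(h^{N-k+1}).$$ Furthermore, $\{c_n\}$ must be symmetric.
   Context: A finite difference approximation of $f^{(k)}(x_* )$ is a linear combination of values of $f$ at the points of a stencil $\{x_n\}$, with coefficients $c_n$. The stencil points are assumed distinct, ordered (increasing in $n$) and contained in $(a,b)$, and are written $x_n=x_*+a_nh$, where $h>0$ is the stencil size and the real numbers $a_n$, independent of $h$, form the fundamental stencil. For $N=2M+1$ odd, the stencil is indexed by $n=-M,\dots,M$, and it is called odd-centered if $a_0=0$ and $a_{-n}=-a_n$ for all $n=1,\dots,M$. The coefficients are symmetric if $c_{-n}=c_n$ for all $n=1,\dots,M$. For real-valued functions $E,g$, $E(h)=\Theta(g(h))$ (as $h\to0^+$) means that there are constants $C_*,C^*>0$ with $C_*|g(h)|\le|E(h)|\le C^*|g(h)|$ for all sufficiently small $h>0$. The approximation has accuracy order exactly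 $r$ if its error is $\Theta(h^r)$.
   Formalization: Uniqueness is among coefficients c_n = w_n h^p (weights and common real exponent p independent of h and f) valid for all admissible f; for arbitrary dependence on h, or for one fixed f, uniqueness fails (add a high power of h to c_0). The order k is taken positive. *)

(* Defs.v *)
From HB Require Import structures.
From mathcomp Require Import all_boot all_order all_algebra.
From mathcomp Require Import all_classical all_reals all_analysis.

Set Implicit Arguments.
Unset Strict Implicit.
Unset Printing Implicit Defensive.

Import Order.TTheory GRing.Theory Num.Theory.
Import numFieldNormedType.Exports.

Local Open Scope classical_set_scope.
Local Open Scope ring_scope.

(* Families indexed by n = -M, ..., M are functions on 'I_(2 * M).+1, the
   ordinal i standing for the index n = i - M; thus n and -n (0 <= n <= M) are
   the ordinals posi n and negi n. *)
Definition posi (M n : nat) : 'I_(2 * M).+1 := inord (M + n).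
Definition negi (M n : nat) : 'I_(2 * M).+1 := inord (M - n).

Definition fundamental_stencil (R : realType) (M : nat)
    (an : 'I_(2 * M).+1 -> R) : Prop :=
  forall i j : 'I_(2 * M).+1, (i < j)%N -> an i < an j.

Definition odd_centered (R : realType) (M : nat)
    (an : 'I_(2 * M).+1 -> R) : Prop :=
  an (posi M 0) = 0 /\
  forall n : nat, (1 <= n <= M)%N -> an (negi M n) = - an (posi M n).

Definition symmetric_coeffs (R : realType) (M : nat)
    (c : 'I_(2 * M).+1 -> R) : Prop :=
  forall n : nat, (1 <= n <= M)%N -> c (negi M n) = c (posi M n).

(* The coefficients depend on the stencil size h, as a common power of h times
   weights independent of h. If c h were an arbitrary function of h, it could
   never be unique: adding to it any term that vanishes fast enough as h -> 0+
   preserves every order of accuracy. The exponent is not prescribed. *)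
Definition coeff_family (R : realType) (M : nat)
    (c : R -> 'I_(2 * M).+1 -> R) : Prop :=
  exists (p : R) (w : 'I_(2 * M).+1 -> R),
    forall h : R, 0 < h -> forall i, c h i = w i * h `^ p.

Definition fd (R : realType) (M : nat) (an : 'I_(2 * M).+1 -> R)
    (c : R -> 'I_(2 * M).+1 -> R) (f : R -> R) (xs h : R) : R :=
  \sum_(i < (2 * M).+1) c h i * f (xs + an i * h).

(* f is r times differentiable on ]a, b[; f is a total function, but only its
   values on ]a, b[ matter. *)
Definition times_differentiable (R : realType) (r : nat) (a b : R)
    (f : R -> R) : Prop :=
  forall j : nat, (j < r)%N ->
  forall x : R, a < x < b -> derivable (derive1n j f) x 1.

Definition accuracy_order_exactly (R : realType) (E : R -> R) (r : nat) : Prop :=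
  E \is 'Theta_(0^'+) (fun h : R => h ^+ r).

(* The coefficients belong to the stencil and not to one particular f, hence the
   quantification over f; for a single f, e.g. f x = (x - xs) ^+ N.+1, they are
   not unique. *)
Definition approximates (R : realType) (M : nat) (r : nat) (a b xs : R)
    (an : 'I_(2 * M).+1 -> R) (N k : nat)
    (c : R -> 'I_(2 * M).+1 -> R) : Prop :=
  forall f : R -> R,
    times_differentiable r a b f ->
    derive1n N.+1 f xs != 0 ->
    accuracy_order_exactly
      (fun h : R => fd an c f xs h - derive1n k f xs) (N - k + 1)%N.

(* Main.v *)
(* The weights w solve the Vandermonde system sum_i w_i a_i^j = k! [j = k],
   j < N, and c_i = w_i h^(-k). The system is invariant under a |-> -a because k
   is even, so w is symmetric and the odd moment of order N vanishes as well.
   The moment of order N + 1 does not: applying the moments to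
   Q(y) = y prod_n (y + a_n^2), which vanishes at every y = -a_i^2, expresses it
   as a nonzero multiple of the coefficient of y^(k/2) in Q, which is positive.
   The Taylor formula with Peano remainder gives the exact order. Conversely,
   testing on polynomials forces the power of h and all moments of order < N. *)

Require Import Defs.
From HB Require Import structures.
From mathcomp Require Import all_boot all_order all_algebra.
From mathcomp Require Import all_classical all_reals all_analysis.
From mathcomp Require Import ring lra zify.
Import Order.TTheory GRing.Theory Num.Theory.
Import numFieldNormedType.Exports.
Local Open Scope classical_set_scope.
Local Open Scope ring_scope.

Set Implicit Arguments.
Unset Strict Implicit.
Unset Printing Implicit Defensive.

(** * Moments of weighted nodes, Vandermonde systems and coefficients of products *)

Definition moment (F : pzRingType) (n : nat) (w x : 'I_n -> F) (j : nat) : F :=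
  \sum_(i < n) w i * x i ^+ j.

Lemma unitmx_Vandermonde (F : fieldType) (n : nat) (x : 'I_n -> F) :
  injective x -> Vandermonde n (\row_i x i) \in unitmx.
Proof.
move=> x_inj; rewrite unitmxE unitfE det_Vandermonde.
apply/prodf_neq0 => i _; apply/prodf_neq0 => j ij; rewrite !mxE subr_eq0.
by apply: contraTneq ij => /x_inj ->; rewrite ltnn.
Qed.

Lemma moment_Vandermonde (F : comPzRingType) (n : nat) (w x : 'I_n -> F) (j : 'I_n) :
  moment w x j = (Vandermonde n (\row_i x i) *m \col_i w i) j 0.
Proof. by rewrite mxE; apply: eq_bigr => i _; rewrite !mxE mulrC. Qed.

Lemma moments_exist (F : fieldType) (n : nat) (x : 'I_n -> F) (m : nat -> F) :
  injective x -> exists w, forall j, (j < n)%N -> moment w x j = m j.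
Proof.
move=> /unitmx_Vandermonde uV.
pose w := invmx (Vandermonde n (\row_i x i)) *m \col_i m i.
exists (fun i => w i 0) => j jn; rewrite (moment_Vandermonde _ _ (Ordinal jn)).
have -> : \col_i w i 0 = w by apply/colP => i; rewrite mxE.
by rewrite mulKVmx// mxE.
Qed.

Lemma moments_inj (F : fieldType) (n : nat) (x w w' : 'I_n -> F) :
  injective x ->
  (forall j, (j < n)%N -> moment w x j = moment w' x j) -> w =1 w'.
Proof.
move=> /unitmx_Vandermonde uV eqm i.
have : \col_i w i = \col_i w' i.
  apply: (can_inj (mulKmx uV)); apply/colP => j.
  by rewrite -!moment_Vandermonde eqm.
by move/colP => /(_ i); rewrite !mxE.
Qed.

(** Serves to turn a polynomial that vanishes at all nodes into a linear relation between
    moments. *)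
Lemma sum_horner_moment (F : comNzRingType) (n d : nat) (w x : 'I_n -> F)
    (p : {poly F}) : (size p <= d)%N ->
  \sum_(i < n) w i * p.[x i] = \sum_(j < d) p`_j * moment w x j.
Proof.
move=> pd; under eq_bigr do rewrite (horner_coef_wide _ pd) mulr_sumr.
rewrite exchange_big; apply: eq_bigr => j _; rewrite mulr_sumr.
by apply: eq_bigr => i _; rewrite mulrCA.
Qed.

(** These coefficients are elementary symmetric functions of positive numbers. In the induction, the
    coefficient of order [j.+1] of [('X + y) * P] is [P_j + y * P_(j+1)], a positive term plus a
    nonnegative one. *)
Lemma coef_prod_XaddC_gt0 (F : numDomainType) (s : seq F) (j : nat) :
  (forall y, y \in s -> 0 < y) -> (j <= size s)%N ->
  0 < (\prod_(y <- s) ('X + y%:P))`_j.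
Proof.
have size_P (t : seq F) : size (\prod_(y <- t) ('X + y%:P)) = (size t).+1.
  rewrite -(size_prod_XsubC t -%R); congr (size (polyseq _)).
  by apply: eq_bigr => y _; rewrite polyCN opprK.
elim: s j => [|y s IHs] j s0; first by rewrite big_nil leqn0 => /eqP->; rewrite coef1.
have y0 : 0 < y by apply: s0; rewrite mem_head.
have {}IHs i : (i <= size s)%N -> 0 < (\prod_(z <- s) ('X + z%:P))`_i.
  by apply: IHs => z zs; apply: s0; rewrite inE zs orbT.
rewrite big_cons mulrDl coefD coefXM coefCM.
case: j => [_|j]; first by rewrite add0r mulr_gt0// IHs.
rewrite /= ltnS => js; apply: ltr_wpDr; last exact: IHs.
(* The index [j.+1] may exceed the degree of the remaining product, where the coefficient is the
   default [0]. *)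
have [jl|jl] := leqP j.+1 (size s); first by rewrite ltW// mulr_gt0// IHs.
by rewrite nth_default ?mulr0// size_P.
Qed.

(** * Mean value theorem and Taylor formula with Peano remainder *)

Lemma MVT_centered (R : realType) (f df : R -> R) (x0 d u : R) :
  (forall x, `|x - x0| < d -> is_derive x 1 f (df x)) -> `|u| < d ->
  exists2 v, `|v| <= `|u| & f (x0 + u) - f x0 = df (x0 + v) * u.
Proof.
move=> fdf ud.
have cont s t : (forall x, x \in `[s, t] -> `|x - x0| < d) ->
    {within `[s, t], continuous f}.
  move=> st; apply: derivable_within_continuous => x /st xd.
  by have [] := fdf _ xd.
have [u0|u0] := leP 0 u.
  have st x : x \in `[x0, x0 + u] -> `|x - x0| < d.
    rewrite in_itv/= => /andP[? ?].
    by apply: le_lt_trans ud; rewrite ger0_norm ?ger0_norm; lra.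
  have [||c] := @MVT_segment R f df x0 (x0 + u) _ _ (cont _ _ st).
  - by rewrite lerDl.
  - by move=> x /subset_itv_oo_cc/st/fdf.
  - rewrite in_itv/= => /andP[c1 c2] E; exists (c - x0).
      by rewrite !ger0_norm; lra.
    by rewrite E; congr (df _ * _); ring.
have st x : x \in `[x0 + u, x0] -> `|x - x0| < d.
  rewrite in_itv/= => /andP[? ?].
  by apply: le_lt_trans ud; rewrite ler0_norm ?ltr0_norm; lra.
have [||c] := @MVT_segment R f df (x0 + u) x0 _ _ (cont _ _ st).
- by rewrite gerDl ltW.
- by move=> x /subset_itv_oo_cc/st/fdf.
- rewrite in_itv/= => /andP[c1 c2] E; exists (c - x0).
    by rewrite ler0_norm ?ltr0_norm; lra.
  rewrite -[LHS]opprB E -mulrN; congr (df _ * _); ring.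
Qed.

(** [F] lists the successive derivatives of [F 0]. The base case is the definition of the derivative
    at [x0]. In the induction step the bound for [F 1], taken at the intermediate point of the mean
    value theorem, gains one factor [u]. *)
Lemma peano_flat (R : realType) (a b x0 : R) (n : nat) (F : nat -> R -> R) :
  a < x0 < b ->
  (forall j x, (j <= n)%N -> a < x < b -> is_derive x 1 (F j) (F j.+1 x)) ->
  (forall j, (j <= n.+1)%N -> F j x0 = 0) ->
  forall e, 0 < e -> exists2 d, 0 < d &
    forall u, `|u| < d -> `|F 0%N (x0 + u)| <= e * `|u| ^+ n.+1.
Proof.
move=> x0ab; elim: n F => [|n IHn] F dF F0 e e0.
  have [dF0 F1] := dF 0%N x0 (leqnn _) x0ab.
  have : h^-1 *: (F 0%N (h *: 1 + x0) - F 0%N x0) @[h --> 0^'] --> 'D_1 (F 0%N) x0.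
    exact: dF0.
  rewrite F1 (F0 0%N)// (F0 1%N)//.
  move/cvgr0Pnorm_le => /(_ _ e0) [d /= d0 H]; exists d => // u ud.
  have [->|u0] := eqVneq u 0; first by rewrite addr0 F0// !normr0 mulr0.
  have := H u; rewrite /ball_/= sub0r normrN => /(_ ud u0).
  rewrite subr0 normrZ normfV [_ *: 1]mulr1 mulrC ler_pdivrMr ?normr_gt0//.
  by rewrite [x0 + u]addrC.
have [||d d0 H] := IHn (fun j => F j.+1) _ _ e e0.
- by move=> j x jn; exact: dF.
- by move=> j jn; exact: F0.
have [d' d'0 Hd'] : exists2 d', 0 < d' & forall x, `|x - x0| < d' -> a < x < b.
  exists (Num.min (x0 - a) (b - x0)); first by rewrite lt_min !subr_gt0.
  by move=> x; rewrite lt_min !ltr_norml; lra.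
exists (Num.min d d'); first by rewrite lt_min d0.
move=> u; rewrite lt_min => /andP[ud ud'].
have [|v vu] := @MVT_centered R (F 0%N) (F 1%N) x0 d' u _ ud'.
  by move=> x /Hd'; exact: dF.
rewrite F0// subr0 => ->; rewrite normrM exprSr mulrA ler_wpM2r//.
apply: le_trans (H v (le_lt_trans vu ud)) _.
by apply: ler_wpM2l; [exact: ltW|rewrite lerXn2r ?nnegrE].
Qed.

Lemma derive1n_horner_shift (R : realType) (p : {poly R}) (x0 : R) (j : nat) :
  derive1n j (fun x => p.[x - x0]) = (fun x => p^`(j).[x - x0]).
Proof.
elim: j => [|j IHj]; first by rewrite derivn0.
rewrite derive1nS IHj derivnS.
have -> : (fun x => p^`(j).[x - x0]) = horner (p^`(j) \Po ('X - x0%:P)).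
  by apply/funext => x; rewrite horner_comp !hornerE.
rewrite -derivE; apply/funext => x.
by rewrite deriv_comp derivXsubC mulr1 horner_comp !hornerE.
Qed.

Lemma is_derive_horner_shift (R : realType) (p : {poly R}) (x0 x : R) :
  is_derive x 1 (fun x => p.[x - x0]) (p^`()).[x - x0].
Proof.
have -> : (fun x => p.[x - x0]) = horner (p \Po ('X - x0%:P)).
  by apply/funext => y; rewrite horner_comp !hornerE.
apply: is_derive_eq.
by rewrite deriv_comp derivXsubC mulr1 horner_comp !hornerE.
Qed.

Lemma times_differentiable_horner (R : realType) (r : nat) (a b x0 : R)
    (p : {poly R}) :
  times_differentiable r a b (fun x => p.[x - x0]).
Proof.
move=> j _ x _; rewrite derive1n_horner_shift.
by have [] := is_derive_horner_shift (p^`(j)) x0 x.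
Qed.

Definition taylor_poly (R : realType) (f : R -> R) (x0 : R) (n : nat) : {poly R} :=
  \poly_(j < n.+1) (derive1n j f x0 / j`!%:R).

(** Subtracting the Taylor polynomial kills all derivatives at [x0] up to order [n.+1], which
    reduces the claim to the flat case. *)
Lemma taylor_peano (R : realType) (a b x0 : R) (n : nat) (f : R -> R) :
  a < x0 < b -> times_differentiable n.+1 a b f ->
  forall e, 0 < e -> exists2 d, 0 < d & forall u, `|u| < d ->
    `|f (x0 + u) - (taylor_poly f x0 n.+1).[u]| <= e * `|u| ^+ n.+1.
Proof.
move=> x0ab df e e0; set Q := taylor_poly f x0 n.+1.
pose F j x := derive1n j f x - (Q^`(j)).[x - x0].
have [||d d0 H] := @peano_flat R a b x0 n F x0ab _ _ e e0.
- move=> j x jn xab; apply: is_deriveB.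
    by rewrite derive1nS derive1E; apply/derivableP/df.
  by rewrite derivnS; exact: is_derive_horner_shift.
- move=> j jn; rewrite /F subrr horner_coef0 coef_derivn addn0 coef_poly ltnS jn.
  by rewrite ffactnn -(mulr_natr (_ / _)) divfK ?subrr// pnatr_eq0 -lt0n fact_gt0.
exists d => // u /H; rewrite /F derivn0 [x0 + u - x0]addrAC subrr add0r.
by [].
Qed.

(** * Reflection of odd-centered stencils and its effect on moments *)

Lemma val_posi (M n : nat) : (n <= M)%N -> posi M n = (M + n)%N :> nat.
Proof. by move=> nM; rewrite inordK// mul2n -addnn ltnS leq_add2l. Qed.

Lemma val_negi (M n : nat) : (n <= M)%N -> negi M n = (M - n)%N :> nat.
Proof. by move=> nM; rewrite inordK//; lia. Qed.

(** [rev_ord] sends [i] to [2 * M - i], which is the reflection of the index [n] to [-n]. Both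
    halves of the stencil and the center are thus covered by one identity. *)
Lemma odd_centered_rev (R : realType) (M : nat) (an : 'I_(2 * M).+1 -> R) i :
  odd_centered an -> an (rev_ord i) = - an i.
Proof.
move=> [a0 aN]; have aN' n : (n <= M)%N -> an (negi M n) = - an (posi M n).
  case: n => [_|n nM]; last exact: aN.
  have -> : negi M 0 = posi M 0 by apply/ord_inj; rewrite val_posi ?val_negi//; lia.
  by rewrite a0 oppr0.
have iM := ltn_ord i; have [iM'|iM'] := leqP i M.
  have -> : rev_ord i = posi M (M - i) by apply/ord_inj; rewrite val_posi /=; lia.
  have {2}-> : i = negi M (M - i) by apply/ord_inj; rewrite val_negi /=; lia.
  by rewrite aN' ?opprK// leq_subr.
have -> : rev_ord i = negi M (i - M) by apply/ord_inj; rewrite val_negi /=; lia.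
have {2}-> : i = posi M (i - M) by apply/ord_inj; rewrite val_posi /=; lia.
by rewrite aN'//; lia.
Qed.

Lemma fundamental_stencil_inj (R : realType) (M : nat) (an : 'I_(2 * M).+1 -> R) :
  fundamental_stencil an -> injective an.
Proof.
move=> an_lt i j eij; have [/an_lt|/an_lt|/ord_inj//] := ltngtP i j.
  by rewrite eij ltxx.
by rewrite eij ltxx.
Qed.

Lemma moment_rev (R : realType) (M : nat) (an w : 'I_(2 * M).+1 -> R) j :
  odd_centered an ->
  moment (w \o @rev_ord _) an j = (-1) ^+ j * moment w an j.
Proof.
move=> aodd; rewrite /moment (reindex_inj rev_ord_inj) mulr_sumr /=.
by apply: eq_bigr => i _; rewrite rev_ordK odd_centered_rev// (exprNn (an i)) mulrCA.
Qed.

(** Reflection keeps even moments and negates odd ones, so [w] and its reflection have the same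
    first [2 * M + 1] moments, and these determine the weights. *)
Lemma moments_even_symmetric (R : realType) (M : nat) (an w : 'I_(2 * M).+1 -> R) :
  fundamental_stencil an -> odd_centered an ->
  (forall j, (j < 2 * M)%N -> odd j -> moment w an j = 0) ->
  forall i, w (rev_ord i) = w i.
Proof.
move=> /fundamental_stencil_inj an_inj aodd m0 i.
apply: (@moments_inj _ _ an (w \o @rev_ord _) w an_inj) => j jM.
rewrite moment_rev//; case: (boolP (odd j)) => oj; last first.
  by rewrite -signr_odd (negPf oj) mul1r.
(* An odd [j <= 2 * M] satisfies [j < 2 * M]. *)
by rewrite m0 ?mulr0//; lia.
Qed.

Lemma moment_top_neq0 (R : realType) (M l : nat) (an w : 'I_(2 * M).+1 -> R) :
  fundamental_stencil an -> odd_centered an -> (1 <= l <= M)%N ->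
  moment w an (2 * l) != 0 ->
  (forall j, (j <= M)%N -> j != l -> moment w an (2 * j) = 0) ->
  moment w an (2 * M.+1) != 0.
Proof.
move=> an_lt aodd /andP[l1 lM] ml m0; apply/negP => /eqP mM.
(* The squares of the nodes of positive index. ['X * P] then vanishes at every [- an i ^+ 2], the
   factor ['X] accounting for the center. *)
pose s := [seq an (posi M n.+1) ^+ 2 | n <- iota 0 M].
pose P := \prod_(y <- s) ('X + y%:P) : {poly R}.
have s0 y : y \in s -> 0 < y.
  move=> /mapP[n]; rewrite mem_iota add0n => /andP[_ nM] ->.
  rewrite exprn_even_gt0//= gt_eqF// -aodd.1; apply: an_lt.
  by rewrite !val_posi//; lia.
have root i : ('X * P).[- an i ^+ 2] = 0.
  have iM := ltn_ord i; rewrite hornerM hornerX.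
  have mems n : (0 < n <= M)%N -> an (posi M n) ^+ 2 \in s.
    move=> nM; apply/mapP; exists n.-1; first by rewrite mem_iota; lia.
    by rewrite prednK//; lia.
  have Ps y : y \in s -> P.[- y] = 0.
    by move=> ys; rewrite horner_prod (big_rem y)//= !hornerE addNr mul0r.
  have [iM'|iM'|iM'] := ltngtP i M.
  - rewrite Ps ?mulr0// -sqrrN -odd_centered_rev//.
    have -> : rev_ord i = posi M (M - i) by apply/ord_inj; rewrite val_posi /=; lia.
    by apply: mems; lia.
  - rewrite Ps ?mulr0//.
    have -> : i = posi M (i - M) by apply/ord_inj; rewrite val_posi /=; lia.
    by apply: mems; lia.
  - have -> : i = posi M 0 by apply/ord_inj; rewrite val_posi /=; lia.
    by rewrite aodd.1 expr0n oppr0 mul0r.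
have sP : (size ('X * P)%R <= M.+2)%N.
  rewrite mulrC size_mulX.
    rewrite ltnS (_ : P = \prod_(y <- s) ('X - (- y)%:P)); last first.
      by apply: eq_bigr => y _; rewrite polyCN opprK.
    by rewrite size_prod_XsubC size_map size_iota.
  (* [size_mulX] requires [P] to be nonzero; its constant coefficient is positive. *)
  have := coef_prod_XaddC_gt0 s0 (leq0n _); rewrite -/P.
  by apply: contraTneq => ->; rewrite coef0 ltxx.
have := sum_horner_moment w (fun i => - an i ^+ 2) sP.
rewrite big1 => [|i _]; last by rewrite root mulr0.
(* Moments at the nodes [- an i ^+ 2] are, up to sign, the even moments of [an]. *)
have mE j : moment w (fun i => - an i ^+ 2) j = (-1) ^+ j * moment w an (2 * j).
  rewrite /moment mulr_sumr; apply: eq_bigr => i _.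
  by rewrite (exprNn (an i ^+ 2)) mulrCA exprM.
have lM2 : (l < M.+2)%N by lia.
(* If the moment of order [2 * M.+1] vanished too, only the term of index [l] would survive. Since
   [1 <= l], its coefficient in ['X * P] is the coefficient of order [l - 1] in [P], which is
   positive. *)
rewrite (bigD1 (Ordinal lM2))//= [X in _ + X]big1 => [|j jl]; last first.
  rewrite mE; have [jM|jM] := leqP j M; first by rewrite m0 ?mulr0.
  have -> : j = M.+1 :> nat by have := ltn_ord j; lia.
  by rewrite mM !mulr0.
rewrite addr0 mE coefXM gtn_eqF// => /esym/eqP.
rewrite !mulf_eq0 signr_eq0 (negPf ml) orbF orbF gt_eqF//.
by apply: coef_prod_XaddC_gt0 => //; rewrite size_map size_iota; lia.
Qed.

(** * Asymptotic estimates as [h] tends to [0] from the right *)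

Lemma near0_right (R : realType) (P : R -> Prop) :
  (\forall h \near 0^'+, P h) <->
  exists2 d : R, 0 < d & forall h, 0 < h < d -> P h.
Proof.
split=> [[d /= d0 H]|[d d0 H]].
  exists d => // h /andP[h0 hd]; apply: H => //=.
  by rewrite /ball_/= sub0r normrN gtr0_norm.
exists d => //= h; rewrite /ball_/= sub0r normrN => hd h0; apply: H.
by rewrite h0 (le_lt_trans (ler_norm _) hd).
Qed.

Lemma accuracy_order_exactlyP (R : realType) (E : R -> R) (r : nat) :
  accuracy_order_exactly E r <->
  exists2 k : R * R, (0 < k.1) && (0 < k.2) &
    exists2 d, 0 < d & forall h, 0 < h < d ->
      k.1 * h ^+ r <= `|E h| /\ `|E h| <= k.2 * h ^+ r.
Proof.
split.
  rewrite /accuracy_order_exactly qualifE => /asboolP[k k0 /near0_right[d d0 H]].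
  exists k => //; exists d => // h hd; have := H _ hd.
  by rewrite /= (ger0_norm (exprn_ge0 r _))// ltW//; case/andP: hd.
move=> [k k0 [d d0 H]]; rewrite /accuracy_order_exactly qualifE.
apply/asboolP; exists k => //; apply/near0_right; exists d => // h hd.
by have := H _ hd; rewrite /= (ger0_norm (exprn_ge0 r _))// ltW//; case/andP: hd.
Qed.

Lemma eq0_of_bigO_expr (R : realType) (z C d : R) (s : nat) :
  (0 < s)%N -> 0 < d -> (forall h, 0 < h < d -> `|z| <= C * h ^+ s) -> z = 0.
Proof.
move=> s0 d0 H; apply/eqP/negPn/negP => z0.
have z0' : 0 < `|z| by rewrite normr_gt0.
have C0 : 0 < `|C| + 1 by rewrite ltr_wpDl.
(* For [h <= 1] and [h <= t], [C * h ^+ s] is at most [(|C| + 1) * t], that is half of [|z|], a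
   contradiction. The [+ 1] covers [C = 0]. *)
pose t := `|z| / (`|C| + 1) / 2.
have t0 : 0 < t by rewrite !divr_gt0.
pose h := Num.min (Num.min (d / 2) 1) t.
have h0 : 0 < h by rewrite !lt_min t0 ltr01 !andbT divr_gt0.
have h1 : h <= 1 by rewrite !ge_min lexx orbT.
have ht : h <= t by rewrite ge_min lexx orbT.
have hd : h < d by rewrite !gt_min; apply/orP; left; apply/orP; left; lra.
have /H : 0 < h < d by rewrite h0 hd.
apply/negP; rewrite -ltNge.
have hs : h ^+ s <= h by rewrite -(prednK s0) exprS ger_pMr// exprn_ile1// ltW.
have : C * h ^+ s <= (`|C| + 1) * t.
  apply: (@le_trans _ _ ((`|C| + 1) * h ^+ s)).
    apply: ler_wpM2r; first by rewrite exprn_ge0// ltW.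
    by rewrite (le_trans (ler_norm _))// lerDl.
  by apply: ler_wpM2l; [exact: ltW|exact: le_trans ht].
move=> /le_lt_trans; apply; rewrite /t mulrA mulrC [_ * (`|z| / _)]mulrC divfK ?gt_eqF//.
lra.
Qed.

(* Evaluating at [h] and [h / 2] gives [2^(-q) * z = z]. *)
Lemma powR_bigO_const (R : realType) (m q z C d : R) (s : nat) :
  (0 < s)%N -> 0 < d -> z != 0 ->
  (forall h, 0 < h < d -> `|m * h `^ q - z| <= C * h ^+ s) -> q = 0 /\ m = z.
Proof.
move=> s0 d0 z0 H.
have q0 : q = 0.
  have E : z - 2^-1 `^ q * z = 0.
    apply: (@eq0_of_bigO_expr _ _ (`|C| * 2^-1 ^+ s + 2^-1 `^ q * `|C|) d s) => // h hd.
    have h2d : 0 < 2^-1 * h < d by case/andP: hd; lra.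
    have h0 : 0 <= h by apply: ltW; case/andP: hd.
    have H1 := H _ hd; have := H _ h2d; rewrite powRM ?invr_ge0// => H2.
    have -> : z - 2^-1 `^ q * z = - (m * (2^-1 `^ q * h `^ q) - z) +
      2^-1 `^ q * (m * h `^ q - z) by ring.
    rewrite (le_trans (ler_normD _ _))// normrN normrM mulrDl lerD//.
      rewrite (le_trans H2)// exprMn mulrA; apply: ler_wpM2r.
        by rewrite exprn_ge0// ltW//; case/andP: hd.
      by apply: ler_wpM2r; [rewrite exprn_ge0// invr_ge0|exact: ler_norm].
    rewrite ger0_norm ?powR_ge0// -mulrA; apply: ler_wpM2l; first exact: powR_ge0.
    rewrite (le_trans H1)//; apply: ler_wpM2r; last exact: ler_norm.
    by rewrite exprn_ge0// ltW//; case/andP: hd.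
  have /eqP : (1 - 2^-1 `^ q) * z = 0 by rewrite mulrBl mul1r.
  rewrite mulf_eq0 (negPf z0) orbF subr_eq0 eq_sym => /eqP E1.
  (* Taking logarithms in [2^-1 ^ q = 1] gives [q * ln 2 = 0]. *)
  have : ln ((2^-1 : R) `^ q) = 0 by rewrite E1 ln1.
  rewrite ln_powR lnV ?posrE// mulrN => /eqP; rewrite oppr_eq0 mulf_eq0.
  have : (0 : R) < ln 2 by apply: ln_gt0; lra.
  by case: eqVneq => // _ ln2 /=; rewrite gt_eqF.
split=> //; apply/eqP; rewrite -subr_eq0; apply/eqP.
apply: (@eq0_of_bigO_expr _ _ C d s) => // h hd.
by have := H _ hd; rewrite q0 powRr0 mulr1.
Qed.

(** * Necessity of the moment conditions, by polynomial test functions *)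

(** Scaling the nodes by [h] multiplies the moment of order [j] by [h ^+ j]; [g] stands for the
    common power of [h] in the coefficients. *)
Lemma fd_horner (R : realType) (M d : nat) (an w : 'I_(2 * M).+1 -> R)
    (p : {poly R}) (c : R -> 'I_(2 * M).+1 -> R) (g xs h : R) :
  (size p <= d)%N -> (forall i, c h i = w i * g) ->
  fd an c (fun x => p.[x - xs]) xs h =
  g * \sum_(j < d) p`_j * (moment w an j * h ^+ j).
Proof.
move=> pd cE; rewrite /fd.
transitivity (g * \sum_i w i * p.[an i * h]).
  rewrite mulr_sumr; apply: eq_bigr => i _.
  by rewrite cE [xs + _]addrC addrK mulrAC mulrC.
rewrite (sum_horner_moment w (fun i => an i * h) pd).
congr (_ * _); apply: eq_bigr => j _; rewrite /moment mulr_suml.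
by congr (_ * _); apply: eq_bigr => i _; rewrite exprMn mulrA.
Qed.

Lemma derive1n_horner_at (R : realType) (p : {poly R}) (x0 : R) (j : nat) :
  derive1n j (fun x => p.[x - x0]) x0 = p`_j * j`!%:R.
Proof.
by rewrite derive1n_horner_shift subrr horner_coef0 coef_derivn addn0 ffactnn mulr_natr.
Qed.

(* The test functions are [u ^+ N.+1 + t * u ^+ j] with [t] in [{0, 1}]: both
   have a nonzero derivative of order [N.+1], and the difference of their errors
   isolates the moment of order [j]. *)
Lemma approximates_moment_bound (R : realType) (r : nat) (a b xs p : R)
    (M N k j : nat) (an w : 'I_(2 * M).+1 -> R) (c : R -> 'I_(2 * M).+1 -> R) :
  (forall h, 0 < h -> forall i, c h i = w i * h `^ p) ->
  approximates r a b xs an N k c -> (k <= N)%N -> (j <= N)%N ->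
  exists C, exists2 d, 0 < d & forall h, 0 < h < d ->
    `|h `^ p * (moment w an j * h ^+ j) - (j == k)%:R * k`!%:R|
      <= C * h ^+ (N - k + 1).
Proof.
move=> cE appr kN jN.
pose P (t : R) : {poly R} := 'X^(N.+1) + t *: 'X^j.
have coefP t i : (P t)`_i = (i == N.+1)%:R + t * (i == j)%:R.
  by rewrite coefD coefZ !coefXn.
have sP t : (size (P t) <= N.+2)%N.
  rewrite (leq_trans (size_polyD _ _))// geq_max size_polyXn leqnn.
  by rewrite (leq_trans (size_scale_leq _ _))// size_polyXn; lia.
have bound t : exists C, exists2 d, 0 < d & forall h, 0 < h < d ->
    `|fd an c (fun x => (P t).[x - xs]) xs h - (P t)`_k * k`!%:R|
      <= C * h ^+ (N - k + 1).
  have /appr : times_differentiable r a b (fun x => (P t).[x - xs]).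
    exact: times_differentiable_horner.
  rewrite derive1n_horner_at coefP eqxx gtn_eqF ?ltnS// mulr0 addr0 mul1r.
  rewrite pnatr_eq0 -lt0n fact_gt0 => /(_ isT)/accuracy_order_exactlyP.
  rewrite derive1n_horner_at => -[K _ [d d0 H]]; exists K.2, d => // h /H[_].
  by [].
have [C0 [d0 d00 H0]] := bound 0; have [C1 [d1 d10 H1]] := bound 1.
exists (C1 + C0), (Num.min d1 d0); first by rewrite lt_min d10.
move=> h; rewrite lt_min => /and3P[h0 hd1 hd0].
have {}H0 : _ <= _ := H0 h _; have {}H1 : _ <= _ := H1 h _.
rewrite mulrDl (le_trans _ (lerD (H1 _) (H0 _))) ?h0//.
(* The quantity to bound is exactly the error for [t = 1] minus the error for [t = 0]. *)
rewrite (le_trans _ (ler_normB _ _))// le_eqVlt; apply/orP; left; apply/eqP.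
congr `| _ |.
rewrite !(fd_horner an xs (sP _) (cE _ h0)) !coefP.
have sum_coefP t (X : nat -> R) : \sum_(i < N.+2) (P t)`_i * X i = X N.+1 + t * X j.
  under eq_bigr do rewrite coefP mulrDl -mulrA !mulr_natl !mulrb.
  rewrite big_split/= -mulr_sumr -!big_mkcond/=.
  have jN2 : (j < N.+2)%N by rewrite ltnS leqW.
  by rewrite (big_pred1 ord_max)// (big_pred1 (Ordinal jN2)).
rewrite !(sum_coefP _ (fun i => moment w an i * h ^+ i)) [k == j]eq_sym; ring.
Qed.

(** For [j = k] the bound says that [m_k * h ^ (p + k)] tends to [k!] at a positive rate, which
    fixes both [p] and [m_k]. For another [j <= N] it then becomes [m_j = O(h ^ (N + 1 - j))], so
    [m_j] vanishes. *)
Lemma approximates_moments (R : realType) (r : nat) (a b xs p : R)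
    (M N k : nat) (an w : 'I_(2 * M).+1 -> R) (c : R -> 'I_(2 * M).+1 -> R) :
  (forall h, 0 < h -> forall i, c h i = w i * h `^ p) ->
  approximates r a b xs an N k c -> (k < N)%N ->
  p = - k%:R /\
  forall j, (j <= N)%N -> moment w an j = (j == k)%:R * k`!%:R.
Proof.
move=> cE appr kN; have bound j (jN : (j <= N)%N) :=
  approximates_moment_bound cE appr (ltnW kN) jN.
have powRX h j : 0 < h -> h `^ p * h ^+ j = h `^ (p + j%:R) :> R.
  by move=> h0; rewrite powRD ?(gt_eqF h0) ?implybT// powR_mulrn// ltW.
have [pk mk] : p + k%:R = 0 /\ moment w an k = k`!%:R.
  have [C [d d0 H]] := bound k (ltnW kN).
  apply: (@powR_bigO_const _ _ _ _ C d (N - k + 1)) => //.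
    by lia.
  move=> h hd; have := H h hd; rewrite eqxx mul1r mulrCA powRX//.
  by case/andP: hd.
split=> [|j jN]; first by apply/eqP; rewrite -addr_eq0 pk.
have [->|jk] := eqVneq j k; first by rewrite mul1r.
rewrite mul0r; have [C [d d0 H]] := bound j jN.
apply: (@eq0_of_bigO_expr _ _ C d (N.+1 - j)) => //; first by lia.
move=> h hd; have h0 : 0 < h by case/andP: hd.
have := H h hd; rewrite (negPf jk) mul0r subr0 mulrCA normrM.
(* Multiplying by [h ^+ k] cancels the factor [h ^ p]; a factor [h ^+ j] is then removed from both
   sides. *)
rewrite -(ler_pM2r (exprn_gt0 k h0)) -!mulrA -exprD.
rewrite [`|_ * h ^+ j|]ger0_norm; last first.
  by apply: mulr_ge0; [exact: powR_ge0|exact/exprn_ge0/ltW].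
rewrite mulrAC powRX// pk powRr0 mul1r.
have -> : (N - k + 1 + k = (N.+1 - j) + j)%N by lia.
by rewrite exprD !mulrA ler_pM2r// exprn_gt0.
Qed.

(** * Sufficiency of the moment conditions *)

Lemma approximates_of_moments (R : realType) (r : nat) (a b xs : R)
    (M N k : nat) (an w : 'I_(2 * M).+1 -> R) (c : R -> 'I_(2 * M).+1 -> R) :
  a < xs < b -> (N < r)%N -> (k <= N)%N ->
  (forall h, 0 < h -> forall i, c h i = w i * h `^ (- k%:R)) ->
  (forall j, (j <= N)%N -> moment w an j = (j == k)%:R * k`!%:R) ->
  moment w an N.+1 != 0 ->
  approximates r a b xs an N k c.
Proof.
move=> xsab Nr kN cE mE mN0 f df fN0; apply/accuracy_order_exactlyP.
have df' : times_differentiable N.+1 a b f.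
  by move=> j jN; apply: df; apply: leq_trans Nr.
set Q := taylor_poly f xs N.+1.
(* [A] is the leading constant of the error. [e] is chosen below so that the Taylor remainders
   contribute at most half of it, whence the final constants [|A| / 2] and [3 |A| / 2]. *)
pose A := Q`_N.+1 * moment w an N.+1.
pose B := \sum_i `|w i| * `|an i| ^+ N.+1.
have A0 : 0 < `|A|.
  rewrite normr_gt0 mulf_neq0// coef_poly leqnn mulf_neq0// invr_eq0.
have B0 : 0 <= B by apply: sumr_ge0 => i _; rewrite mulr_ge0// exprn_ge0.
pose e := `|A| / 2 / (B + 1).
have e0 : 0 < e by rewrite !divr_gt0// ltr_wpDl.
have eB : e * B <= `|A| / 2.
  by rewrite /e mulrAC ler_pdivrMr ?ltr_wpDl// ler_wpM2l ?divr_ge0// lerDl.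
have [d d0 Hd] := taylor_peano xsab df' e0.
(* [D] dominates every [|an i|], so [h < d / D] puts all offsets [an i * h] within the radius
   [d]. *)
pose D := 1 + \sum_i `|an i|.
have D0 : 0 < D by rewrite ltr_pwDl// sumr_ge0.
exists (`|A| / 2, `|A| + `|A| / 2); first by rewrite /= addr_gt0 ?divr_gt0.
exists (d / D); first by rewrite divr_gt0.
move=> h /andP[h0 hd].
have hN1 : h ^+ N.+1 = h ^+ k * h ^+ (N - k + 1).
  by rewrite -exprD addn1 -subSn// subnKC// leqW.
have splitE : fd an c f xs h - derive1n k f xs =
    A * h ^+ (N - k + 1) +
    h `^ (- k%:R) * \sum_i w i * (f (xs + an i * h) - Q.[an i * h]).
  have sQ : (size Q <= N.+2)%N by exact: size_poly.
  have -> : fd an c f xs h = fd an c (fun x => Q.[x - xs]) xs h +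
      h `^ (- k%:R) * \sum_i w i * (f (xs + an i * h) - Q.[an i * h]).
    rewrite /fd mulr_sumr -big_split; apply: eq_bigr => i _ /=.
    by rewrite cE// [xs + _ - xs]addrAC subrr add0r; ring.
  rewrite addrAC; congr (_ + _).
  (* In the sum over the orders up to [N.+1] only two terms remain: order [k] reproduces the
     derivative, and order [N.+1] gives [A * h ^+ (N - k + 1)]. *)
  rewrite (fd_horner an xs sQ (cE _ h0)) big_ord_recr/= mulrDr.
  have kN1 : (k < N.+1)%N by [].
  rewrite (bigD1 (Ordinal kN1))//= big1 => [|i ik]; last first.
    rewrite mE; last by rewrite -ltnS.
    by rewrite (negPf ik : (i == k :> nat) = false) !mul0r mulr0.
  rewrite mE// eqxx mul1r addr0 powR_invn ?ltW//.
  rewrite [Q`_k]coef_poly (ltn_trans kN1)//.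
  have kf : k`!%:R != 0 :> R by rewrite pnatr_eq0 -lt0n fact_gt0.
  have hk : h ^+ k != 0 by rewrite expf_neq0// gt_eqF.
  by rewrite hN1 /A; field; rewrite kf hk.
set rem := h `^ (- k%:R) * _ in splitE.
have remB : `|rem| <= `|A| / 2 * h ^+ (N - k + 1).
  have : `|rem| <= h `^ (- k%:R) * (e * B * h ^+ N.+1).
    rewrite normrM ger0_norm ?powR_ge0//; apply: ler_wpM2l; first exact: powR_ge0.
    rewrite mulr_sumr mulr_suml (le_trans (ler_norm_sum _ _ _))//.
    apply: ler_sum => i _; rewrite normrM.
    apply: (le_trans (ler_wpM2l (normr_ge0 _) (Hd _ _))).
      rewrite normrM (gtr0_norm h0) (le_lt_trans _ (_ : D * h < d))//.
        apply: ler_wpM2r; first exact: ltW.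
        rewrite /D (bigD1 i)//= addrCA lerDl addr_ge0// sumr_ge0//.
      by rewrite mulrC -ltr_pdivlMr.
    by rewrite normrM exprMn (gtr0_norm h0) le_eqVlt; apply/orP; left; apply/eqP; ring.
  move=> /le_trans; apply.
  have -> : h `^ (- k%:R) * (e * B * h ^+ N.+1) = e * B * h ^+ (N - k + 1).
    rewrite powR_invn ?ltW//.
    by rewrite hN1 mulrCA mulKf// expf_neq0// gt_eqF.
  by apply: ler_wpM2r => //; rewrite exprn_ge0// ltW.
have hs : 0 <= h ^+ (N - k + 1) by rewrite exprn_ge0// ltW.
have AE : `|A * h ^+ (N - k + 1)| = `|A| * h ^+ (N - k + 1).
  by rewrite normrM (ger0_norm hs).
rewrite splitE /=; split.
  by have := lerB_normD (A * h ^+ (N - k + 1)) rem; rewrite AE; lra.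
by have := ler_normD (A * h ^+ (N - k + 1)) rem; rewrite AE; lra.
Qed.

(** * Existence, uniqueness and symmetry of the coefficients *)

Unset Implicit Arguments.
Set Strict Implicit.

Theorem theorem2p7 (R : realType) (a b xs : R) (N k l M r : nat)
    (an : 'I_(2 * M).+1 -> R)
    (hxs : a < xs < b)
    (hl : (1 <= l)%N)
    (hk : k = (2 * l)%N)
    (hN : N = (2 * M + 1)%N)
    (hNk : (1 <= N - k)%N)
    (hr : (N + 1 <= r)%N)
    (han : fundamental_stencil an)
    (hodd : odd_centered an) :
  exists c : R -> 'I_(2 * M).+1 -> R,
    [/\ coeff_family c,
        approximates r a b xs an N k c,
        (forall c' : R -> 'I_(2 * M).+1 -> R,
           coeff_family c' -> approximates r a b xs an N k c' ->
           forall h : R, 0 < h -> forall i, c' h i = c h i)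
      & forall h : R, 0 < h -> symmetric_coeffs (c h)].
Proof.
have an_inj := fundamental_stencil_inj han.
have kN : (k < N)%N by lia.
have [w mw] := moments_exist (fun j => (j == k)%:R * k`!%:R) an_inj.
have w_sym i : w (rev_ord i) = w i.
  apply: (moments_even_symmetric han hodd) => // j jM oj.
  by rewrite mw ?ltnS 1?ltnW// (_ : (j == k) = false) ?mul0r//; lia.
(* The [N] nodes prescribe only the moments of order below [N]. The moment of odd order [N] is
   negated by reflection, yet unchanged as [w] is symmetric; this is the extra order of accuracy. *)
have mwN : moment w an N = 0.
  have := moment_rev w N hodd.
  have -> : moment (w \o @rev_ord _) an N = moment w an N.
    by apply: eq_bigr => i _; rewrite /= w_sym.
  by rewrite -signr_odd (_ : odd N) ?expr1; [lra|lia].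
have mE j : (j <= N)%N -> moment w an j = (j == k)%:R * k`!%:R.
  rewrite leq_eqVlt => /predU1P[->|jN]; last by apply: mw; lia.
  by rewrite mwN gtn_eqF// mul0r.
have k_fact : k`!%:R != 0 :> R by rewrite pnatr_eq0 -lt0n fact_gt0.
exists (fun h i => w i * h `^ (- k%:R)); split.
- by exists (- k%:R), w.
- apply: (approximates_of_moments (w := w)) => //; [lia|lia|].
  have -> : N.+1 = (2 * M.+1)%N by lia.
  apply: (@moment_top_neq0 _ _ l) => //; first by lia.
    by rewrite mE; [rewrite hk eqxx mul1r -hk|lia].
  move=> j jM jl; rewrite mE; last by lia.
  by rewrite (_ : (_ == k) = false) ?mul0r//; apply/negbTE; lia.
- move=> c' [p [w' c'E]] appr h h0 i.
  (* The competitor has the same power of [h] and the same moments, hence the same weights by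
     invertibility of the Vandermonde matrix. *)
  have [pE mw'] := approximates_moments c'E appr kN.
  rewrite c'E// pE (@moments_inj _ _ an w' w an_inj)// => j jM.
  by rewrite mw' ?mE//; lia.
(* [rev_ord] exchanges [negi M n] and [posi M n]. *)
- move=> h _ n /andP[_ nM]; rewrite -w_sym; congr (w _ * _).
  by apply/ord_inj; rewrite /= val_posi// val_negi//; lia.
Qed.
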